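(* Let $g_r, g_f \in \mathbb{R}^d$ and let $Q>0$, $R>0$. Put $\kappa := g_r\cdot g_f$, $\; g_{r,\perp} := g_r - \frac{g_r\cdot g_f}{\|g_f\|^2}\, g_f$, and $\kappa_1 := -\frac{Q\|g_r\|}{R}$. Assume $Q \le R\|g_f\|$. Then the minimum $$F_r^* := \min\{\, g_r\cdot \Delta w \;:\; \Delta w\in\mathbb{R}^d,\ g_f\cdot \Delta w \ge Q,\ \|\Delta w\|\le R \,\}$$ is achieved via the optimal update $\Delta w^*$ given by $$\Delta w^* = \begin{cases} -\dfrac{R}{\|g_r\|}\, g_r & \text{if } \kappa\le\kappa_1,\\[6pt] \dfrac{Q}{\|g_f\|^2}\, g_f - \sqrt{R^2-\dfrac{Q^2}{\|g_f\|^2}}\;\dfrac{g_{r,\perp}}{\|g_{r,\perp}\|} & \text{otherwise.}\end{cases}$$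
   Context: $\cdot$ is the Euclidean inner product and $\|\cdot\|$ the Euclidean norm on $\mathbb{R}^d$. In the application, $g_r$ and $g_f$ are the gradients, at the current model weights, of the average loss on the retain data and on the forget data respectively, and $\Delta w$ is the weight update in one iteration; $F_r^*$ is called the minimum cost of forgetting. The statement uses $g_r,g_f$ only as vectors in $\mathbb{R}^d$. Degenerate cases are read as follows: when $g_{r,\perp}=0$, the second term of the second branch is taken to be $0$, so that the update there is $\frac{Q}{\|g_f\|^2}g_f$; the case $g_r=0$ is counted in the second branch, again with update $\frac{Q}{\|g_f\|^2}g_f$. *)

(* Defs.v *)
From mathcomp Require Import all_boot all_order all_algebra.
From mathcomp Require Import classical_sets reals.

Set Implicit Arguments.
Unset Strict Implicit.
Unset Printing Implicit Defensive.

Import Order.TTheory GRing.Theory Num.Theory.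
Local Open Scope classical_set_scope.
Local Open Scope ring_scope.

Section Definitions.
Variables (R : realType) (d : nat).
Implicit Types (u v gr gf dw : 'rV[R]_d) (Q rad : R).

Definition dot u v : R := \sum_(i < d) u 0 i * v 0 i.

(* Not the norm `|u| of MathComp-Analysis on matrices, which is the sup norm. *)
Definition enorm u : R := Num.sqrt (dot u u).

(* [rad] is the bound on the norm of the update, written R on paper. *)
Definition feasible gf Q rad : set 'rV[R]_d :=
  [set dw | Q <= dot gf dw /\ enorm dw <= rad].

Definition costs gr gf Q rad : set R :=
  [set dot gr dw | dw in feasible gf Q rad].

Definition is_minimum (A : set R) (m : R) : Prop := A m /\ lbound A m.

(* An infimum by definition; that it is attained has to be stated separately,
   with [is_minimum]. *)
Definition min_forgetting_cost gr gf Q rad : R := inf (costs gr gf Q rad).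

Definition perp_part gr gf : 'rV[R]_d :=
  gr - (dot gr gf / enorm gf ^+ 2) *: gf.

Definition kappa1 gr Q rad : R := - (Q * enorm gr / rad).

(* If [gr = 0] then the inequality in the test holds (0 <= 0), but the second
   formula is meant, hence the first conjunct. If [perp_part gr gf = 0] then
   the last term of the second formula is a multiple of the zero vector, so it
   is 0, as intended (this includes the case [gr = 0]). *)
Definition optimal_update gr gf Q rad : 'rV[R]_d :=
  if (gr != 0) && (dot gr gf <= kappa1 gr Q rad) then
    - (rad / enorm gr) *: gr
  else
    (Q / enorm gf ^+ 2) *: gf
    - Num.sqrt (rad ^+ 2 - Q ^+ 2 / enorm gf ^+ 2)
      *: ((enorm (perp_part gr gf))^-1 *: perp_part gr gf).

End Definitions.

(* Main.v *)
(** Both branches are instances of one sufficient optimality criterion of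
    Karush-Kuhn-Tucker type: if [m *: gr = l *: gf - n *: w] with [m > 0],
    [l, n >= 0] and complementary slackness, then for feasible [v] the quantity
    [m * gr.(v - w)] is [l * gf.(v - w) - n * w.(v - w)], and both terms are
    nonnegative. In the first branch [l = 0]; in the second branch, writing
    [s] for the square root and [P] for the norm of the perpendicular part,
    [m = s], [n = P] and [l = (s * gr.gf + Q * P) / |gf|^2]. This fails only
    when [s = 0], in which case the feasible set is a singleton. *)
Require Import Defs.
From mathcomp Require Import all_boot all_order all_algebra.
From mathcomp Require Import classical_sets reals.
From mathcomp Require Import ring lra.

Import Order.TTheory GRing.Theory Num.Theory.
Local Open Scope ring_scope.

Section EuclideanSpace.
Context {R : realType} {d : nat}.
Implicit Types (u v w gr gf : 'rV[R]_d) (a Q rad : R).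

Lemma dotC u v : dot u v = dot v u.
Proof. by apply: eq_bigr => i _; rewrite mulrC. Qed.

Lemma dotDl u v w : dot (u + v) w = dot u w + dot v w.
Proof. by rewrite -big_split; apply: eq_bigr => i _; rewrite !mxE mulrDl. Qed.

Lemma dotZl a u v : dot (a *: u) v = a * dot u v.
Proof. by rewrite mulr_sumr; apply: eq_bigr => i _; rewrite !mxE mulrA. Qed.

Lemma dotNl u v : dot (- u) v = - dot u v.
Proof. by rewrite -scaleN1r dotZl mulN1r. Qed.

Lemma dotDr u v w : dot u (v + w) = dot u v + dot u w.
Proof. by rewrite dotC dotDl !(dotC u). Qed.

Lemma dotZr a u v : dot u (a *: v) = a * dot u v.
Proof. by rewrite dotC dotZl dotC. Qed.

Lemma dotNr u v : dot u (- v) = - dot u v.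
Proof. by rewrite dotC dotNl dotC. Qed.

Lemma dot_ge0 u : 0 <= dot u u.
Proof. by apply: sumr_ge0 => i _; rewrite -expr2 sqr_ge0. Qed.

Lemma dot_eq0 u : (dot u u == 0) = (u == 0).
Proof.
apply/eqP/eqP => [/psumr_eq0P u0|->]; last first.
  by apply: big1 => i _; rewrite mxE mul0r.
apply/rowP => i; rewrite mxE; apply/eqP; rewrite -sqrf_eq0 expr2.
by apply/eqP/u0 => // j _; rewrite -expr2 sqr_ge0.
Qed.

Lemma enorm_ge0 u : 0 <= enorm u.
Proof. exact: sqrtr_ge0. Qed.

Lemma sqr_enorm u : enorm u ^+ 2 = dot u u.
Proof. by rewrite sqr_sqrtr // dot_ge0. Qed.

Lemma enorm_eq0 u : (enorm u == 0) = (u == 0).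
Proof. by rewrite -sqrf_eq0 sqr_enorm dot_eq0. Qed.

Lemma enorm_le u a : 0 <= a -> (enorm u <= a) = (dot u u <= a ^+ 2).
Proof. by move=> a0; rewrite -sqr_enorm ler_sqr // nnegrE enorm_ge0. Qed.

Lemma is_minimum_inf (A : set R) a : is_minimum A a -> inf A = a.
Proof.
move=> [Aa lbA]; apply/eqP; rewrite eq_le; apply/andP; split.
- by apply: ge_inf => //; exists a.
- by apply: lb_le_inf => //; exists a.
Qed.

Lemma dot_perp_part gr gf : gf != 0 -> dot (perp_part gr gf) gf = 0.
Proof.
by move=> gf0; rewrite dotDl dotNl dotZl sqr_enorm divfK ?dot_eq0 // subrr.
Qed.

Lemma kkt_optimal (gr gf w v : 'rV[R]_d) Q rad (m l n : R) :
  0 <= rad -> 0 < m -> 0 <= l -> 0 <= n ->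
  m *: gr = l *: gf - n *: w ->
  l * (dot gf w - Q) = 0 -> n * (dot w w - rad ^+ 2) = 0 ->
  feasible gf Q rad v -> dot gr w <= dot gr v.
Proof.
move=> rad0 m0 l0 n0 E lw nw [Qv]; rewrite enorm_le // => vrad.
have eqv u : m * dot gr u = l * dot gf u - n * dot w u.
  by rewrite -dotZl E dotDl dotNl !dotZl.
have := dot_ge0 (v - w); rewrite dotDl !dotDr !dotNl !dotNr (dotC v w) => vw.
rewrite -(ler_pM2l m0) !eqv.
have h1 : 0 <= l * (dot gf v - Q) by rewrite mulr_ge0 // subr_ge0.
(* Expanding [|v - w|^2 >= 0] with [v.v <= rad^2] bounds [2 * w.v], in place of Cauchy-Schwarz;
   slackness then turns [n * rad^2] into [n * w.w]. *)
have h2 : 0 <= n * (rad ^+ 2 + dot w w - 2 * dot w v).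
  by apply: mulr_ge0 => //; lra.
lra.
Qed.

(* The equality case of Cauchy-Schwarz: [Q = rad * |gf|]. *)
Lemma feasible_tight (gf v : 'rV[R]_d) Q rad :
  0 <= rad -> 0 < Q -> gf != 0 -> rad ^+ 2 = Q ^+ 2 / dot gf gf ->
  feasible gf Q rad v -> v = (Q / dot gf gf) *: gf.
Proof.
move=> rad0 Q0 gf0 radE [Qv]; rewrite enorm_le // => vrad.
have N0 : 0 < dot gf gf by rewrite lt_def dot_eq0 gf0 dot_ge0.
apply/eqP; rewrite -subr_eq0 -dot_eq0 eq_le dot_ge0 andbT.
rewrite dotDl !dotDr !dotNl !dotNr !dotZl !dotZr (dotC v gf) divfK ?gt_eqF //.
(* With [c = Q / gf.gf], the squared distance [v.v - 2 * c * gf.v + c * Q] is at most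
   [rad^2 - c * Q = 0]. *)
have h : 0 <= Q / dot gf gf * (dot gf v - Q).
  by rewrite mulr_ge0 ?subr_ge0 // divr_ge0 // ltW.
have e : Q / dot gf gf * Q = rad ^+ 2 by rewrite radE; field; rewrite gt_eqF.
lra.
Qed.

Lemma aligned_update_optimal (gr gf : 'rV[R]_d) Q rad :
  0 < rad -> gr != 0 -> dot gr gf <= kappa1 gr Q rad ->
  let w := - (rad / enorm gr) *: gr in
  feasible gf Q rad w /\
  forall v, feasible gf Q rad v -> dot gr w <= dot gr v.
Proof.
move=> rad0 gr0 kle w.
have G0 : 0 < enorm gr by rewrite lt_def enorm_eq0 gr0 enorm_ge0.
have ww : dot w w = rad ^+ 2.
  by rewrite dotZl dotZr -sqr_enorm; field; rewrite gt_eqF.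
split.
  split; last by rewrite enorm_le ?ww // ltW.
  rewrite dotZr dotC mulNr -mulrN.
  have c0 : 0 < rad / enorm gr by rewrite divr_gt0.
  (* The branch test is the constraint [Q <= gf.w] divided by the positive factor [rad / enorm gr],
     up to sign. *)
  have -> : Q = rad / enorm gr * (Q * enorm gr / rad).
    by field; rewrite !gt_eqF.
  by rewrite ler_pM2l // lerNr.
move=> v fv.
apply: (@kkt_optimal gr gf w v Q rad 1 0 (enorm gr / rad)) => //.
- exact: ltW.
- by rewrite divr_ge0 // ltW.
- rewrite scale1r scale0r sub0r scalerA -scaleNr.
  rewrite (_ : - _ = 1) ?scale1r //.
  by field; rewrite !gt_eqF.
- by rewrite mul0r.
- by rewrite ww subrr mulr0.
Qed.

(** Sign of the multiplier [l], with [a = gr.gf], [P = |p|] for the perpendicular part [p],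
    [G = |gr|] and [N = |gf|^2]. Were it negative, then [a < 0], and squaring [Q * P < - (a * s)]
    would give [Q^2 * G^2 < a^2 * rad^2], whereas the last hypothesis squares to the reverse
    inequality. *)
Lemma kkt_multiplier_ge0 (a s P G N Q rad : R) :
  0 < Q -> 0 < rad -> 0 <= s -> 0 <= P -> 0 <= G -> N != 0 ->
  s ^+ 2 = rad ^+ 2 - Q ^+ 2 / N -> G ^+ 2 = a ^+ 2 / N + P ^+ 2 ->
  - (Q * G / rad) <= a -> 0 <= a * s + Q * P.
Proof.
move=> Q0 rad0 s0 P0 G0 N0 sE GE aG; rewrite leNgt; apply/negP => neg.
have QP0 : 0 <= Q * P by rewrite mulr_ge0 // ltW.
have sq : (Q * P) ^+ 2 < (- (a * s)) ^+ 2 by rewrite ltr_sqr ?nnegrE; lra.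
have a0 : a < 0.
  by rewrite ltNge; apply/negP => a0; have := mulr_ge0 a0 s0; lra.
have aG' : - (a * rad) <= Q * G.
  by rewrite -mulNr -ler_pdivlMr // lerNl.
have : (- (a * rad)) ^+ 2 <= (Q * G) ^+ 2.
  rewrite ler_sqr // nnegrE; first by rewrite -mulNr mulr_ge0 //; lra.
  by rewrite mulr_ge0 // ltW.
rewrite leNgt => /negP; apply.
rewrite sqrrN in sq; move: sq; rewrite !sqrrN !exprMn sE GE.
have -> : Q ^+ 2 * (a ^+ 2 / N + P ^+ 2)
    = a ^+ 2 * (Q ^+ 2 / N) + Q ^+ 2 * P ^+ 2.
  by ring.
lra.
Qed.

(** The candidate lies on the hyperplane [gf.w = Q]. Inside it the cost falls fastest along [- p],
    and [w] goes that way until it meets the sphere of radius [rad], unless [p = 0]. *)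
Lemma boundary_update_optimal (gr gf : 'rV[R]_d) Q rad :
  0 < Q -> 0 < rad -> Q <= rad * enorm gf -> kappa1 gr Q rad <= dot gr gf ->
  let p := perp_part gr gf in
  let w := (Q / enorm gf ^+ 2) *: gf
    - Num.sqrt (rad ^+ 2 - Q ^+ 2 / enorm gf ^+ 2) *: ((enorm p)^-1 *: p) in
  feasible gf Q rad w /\
  forall v, feasible gf Q rad v -> dot gr w <= dot gr v.
Proof.
move=> Q0 rad0 hfeas kge p.
have gf0 : gf != 0.
  rewrite -enorm_eq0; apply/eqP => N0.
  by move: hfeas; rewrite N0 mulr0 leNgt Q0.
have pgf : dot p gf = 0 by exact: dot_perp_part.
have gfp : dot gf p = 0 by rewrite dotC.
have grE : gr = (dot gr gf / dot gf gf) *: gf + p.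
  by rewrite -sqr_enorm addrC subrK.
clearbody p.
have N0 : 0 < dot gf gf by rewrite lt_def dot_eq0 gf0 dot_ge0.
(* Ensures that [Num.sqrt] is a true square root here and not its default value 0. *)
have disc0 : 0 <= rad ^+ 2 - Q ^+ 2 / dot gf gf.
  rewrite subr_ge0 ler_pdivrMr // -sqr_enorm -exprMn ler_sqr // nnegrE.
    exact: ltW.
  by rewrite mulr_ge0 ?enorm_ge0 // ltW.
rewrite sqr_enorm.
set s := Num.sqrt _ => w.
have s0 : 0 <= s by exact: sqrtr_ge0.
have sE : s ^+ 2 = rad ^+ 2 - Q ^+ 2 / dot gf gf by rewrite sqr_sqrtr.
have P0 := enorm_ge0 p.
have gfw : dot gf w = Q.
  by rewrite dotDr dotNr !dotZr gfp !mulr0 subr0 divfK ?gt_eqF.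
have wwE : dot w w =
    Q ^+ 2 / dot gf gf + s ^+ 2 * ((enorm p)^-1 * enorm p) ^+ 2.
  rewrite dotDl dotNl !dotDr !dotNr !dotZl !dotZr gfp pgf -(sqr_enorm p).
  rewrite divfK ?gt_eqF //; ring.
have fw : feasible gf Q rad w.
  split; first by rewrite gfw.
  rewrite (enorm_le _ _ (ltW rad0)) wwE.
  have [->|p0] := eqVneq (enorm p) 0.
    by rewrite mulr0 expr0n mulr0 addr0 -subr_ge0.
  by rewrite mulVf // expr1n mulr1 sE addrC subrK.
split=> // v fv.
have [sz|sn0] := eqVneq s 0.
  have radE : rad ^+ 2 = Q ^+ 2 / dot gf gf.
    by apply/eqP; rewrite -subr_eq0 -sE sz expr0n.
  by rewrite (feasible_tight _ _ _ _ (ltW rad0) Q0 gf0 radE fv)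
             (feasible_tight _ _ _ _ (ltW rad0) Q0 gf0 radE fw).
have GE : enorm gr ^+ 2 = dot gr gf ^+ 2 / dot gf gf + enorm p ^+ 2.
  rewrite !sqr_enorm {1 2}grE dotDl !dotDr !dotZl !dotZr gfp pgf.
  by field; rewrite gt_eqF.
have l0 : 0 <= dot gr gf * s + Q * enorm p.
  by apply: kkt_multiplier_ge0 sE GE kge; rewrite ?enorm_ge0 ?gt_eqF.
apply: (@kkt_optimal gr gf w v Q rad s
  ((dot gr gf * s + Q * enorm p) / dot gf gf) (enorm p)) => //.
- exact: ltW.
- by rewrite lt_def sn0.
- by rewrite divr_ge0 // ltW.
- (* This includes [p = 0], where the inverse of the norm is the junk value 0. *)
  have Pp : (enorm p * (enorm p)^-1) *: p = p.
    have [/eqP|p0] := eqVneq (enorm p) 0; last by rewrite mulfV // scale1r.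
    by rewrite enorm_eq0 => /eqP ->; rewrite scaler0.
  rewrite {1}grE -{1}Pp /w; apply/rowP => i; rewrite !mxE.
  by ring.
- by rewrite gfw subrr mulr0.
(* If [p = 0], then [w] may lie strictly inside the ball, but the multiplier [n = |p|] vanishes. *)
- have [->|p0] := eqVneq (enorm p) 0; first by rewrite mul0r.
  by rewrite wwE mulVf // expr1n mulr1 sE addrCA subrr addr0 subrr mulr0.
Qed.

End EuclideanSpace.

Theorem proposition4p3 (R : realType) (d : nat) (gr gf : 'rV[R]_d) (Q rad : R)
    (hQ : 0 < Q) (hrad : 0 < rad) (hfeas : Q <= rad * enorm gf) :
  let Fr := min_forgetting_cost gr gf Q rad in
  let dw := optimal_update gr gf Q rad in
  [/\ is_minimum (costs gr gf Q rad) Fr,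
      feasible gf Q rad dw
    & dot gr dw = Fr].
Proof.
move=> Fr dw.
have [fdw opt] : feasible gf Q rad dw /\
    forall v, feasible gf Q rad v -> dot gr dw <= dot gr v.
  rewrite /dw /optimal_update; case: ifPn => [/andP[gr0 kle]|].
    exact: aligned_update_optimal.
  rewrite negb_and negbK -ltNge => /orP k.
  apply: boundary_update_optimal => //.
  (* For [gr = 0] both [kappa1] and [gr.gf] are 0, which the non-strict hypothesis of the lemma
     allows. *)
  case: k => [/eqP ->|/ltW //].
  have -> : dot (0 : 'rV[R]_d) gf = 0 by rewrite -(scale0r gf) dotZl mul0r.
  by rewrite oppr_le0 divr_ge0 ?mulr_ge0 ?enorm_ge0 // ltW.
have min : is_minimum (costs gr gf Q rad) (dot gr dw).
  by split; [exists dw | move=> _ [v fv <-]; exact: opt].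
have FrE : Fr = dot gr dw by exact: is_minimum_inf.
by rewrite FrE.
Qed.
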